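(* Let $H,T,S,\mathcal{D},\lambda,\varphi_n,\psi_n,E_n$ be as in the context. Then $$H^\dagger\psi_n=\overline{E_n}\,\psi_n,\qquad n\ge 0,$$ and $$S^\dagger\psi_0=0,\qquad S^\dagger\psi_n=\psi_{n-1},\quad n\ge1.$$
   Context: $\mathcal{H}$ is a Hilbert space with scalar product $\langle\cdot,\cdot\rangle$ (linear in the second variable) and norm $\|\cdot\|$. $H,T,S$ are operators on $\mathcal{H}$, not necessarily bounded, with adjoints $H^\dagger,T^\dagger,S^\dagger$ ($H\ne H^\dagger$ is allowed), and $\mathcal{D}\subseteq\mathcal{H}$ is a dense subspace which is stable under the action of $H,T,S$ and their adjoints; commutators $[X,Y]=XY-YX$ are understood on $\mathcal{D}$. It is assumed that, for some $\lambda\in\mathbb{C}$, $[H,S]=\lambda S[T,S]$; that $[H,[T,S]]=0$; that all the eigenvalues of $H$ are non-degenerate (multiplicity one); that a non-zero $\varphi_0\in\mathcal{D}$ exists with $H\varphi_0=0$; that the vectors $\varphi_n=S^n\varphi_0$, $n\ge0$, are all non-zero; and that $\mathcal{F}_\varphi=\{\varphi_n,\ n\ge0\}$ is a basis for $\mathcal{H}$. Under these assumptions $[T,S]\varphi_n=\mu_n\varphi_n$ with $\mu_n=\langle\varphi_n,[T,S]\varphi_n\rangle/\|\varphi_n\|^2$, where it is assumed that $\mu_n\ne0$ for all $n\ge0$, and $H\varphi_n=E_n\varphi_n$ with $E_0=0$ and $E_n=\lambda\sum_{k=0}^{n-1}\mu_k$ for $n\ge1$. $\mathcal{F}_\psi=\{\psi_n,\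 n\ge0\}$ is the unique basis of $\mathcal{H}$ biorthonormal to $\mathcal{F}_\varphi$, that is $\langle\varphi_n,\psi_m\rangle=\delta_{n,m}$ for all $n,m\ge0$, so that every $f\in\mathcal{H}$ can be expanded as $f=\sum_{n}\langle\varphi_n,f\rangle\psi_n=\sum_{n}\langle\psi_n,f\rangle\varphi_n$.
   Formalization: Each identity is asserted for those n for which ψ_n lies in the domain of H† (respectively S†); the stated assumptions do not imply this membership, and without it the left-hand side is undefined. *)

(* Defs.v *)
From HB Require Import structures.
From mathcomp Require Import all_boot all_order all_algebra.
From mathcomp Require Import sesquilinear complex.
From mathcomp Require Import all_classical all_reals all_analysis.

Set Implicit Arguments.
Unset Strict Implicit.
Unset Printing Implicit Defensive.

Import Order.TTheory GRing.Theory Num.Theory.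
Import numFieldNormedType.Exports.

Local Open Scope classical_set_scope.
Local Open Scope ring_scope.
Local Open Scope complex_scope.

Section Hilbert.
Context {R : realType} {V : completeNormedModType R[i]}.

(* A positive definite form B of the library is linear in its first argument
   and conjugate-linear in its second one; the scalar product used here is
   linear in the second argument, whence the swap. *)
Definition inner (B : {dot V for Num.conj}) (x y : V) : R[i] := B y x.

(* V, which is complete for its norm, is a Hilbert space for B. *)
Definition norm_of_inner (B : {dot V for Num.conj}) : Prop :=
  forall x : V, `|x| ^+ 2 = inner B x x.

Definition subspace_set (D : set V) : Prop :=
  D 0 /\ forall (a : R[i]) (u v : V), D u -> D v -> D (a *: u + v).

(* A partially defined operator; the values of [app] outside [dom] are
   irrelevant. *)
Record operator := Operator { dom : set V; app :> V -> V }.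

Definition linear_operator (A : operator) : Prop :=
  subspace_set (dom A) /\
  forall (a : R[i]) (u v : V), dom A u -> dom A v ->
    A (a *: u + v) = a *: A u + A v.

(* y is in the domain of the adjoint iff some z satisfies
   <z, x> = <y, A x> for all x in the domain of A; when A is densely defined
   this z is unique and is the value of the adjoint at y. *)
Definition adjoint (B : {dot V for Num.conj}) (A : operator) : operator :=
  let graph y := [set z | forall x, dom A x -> inner B z x = inner B y (A x)] in
  Operator [set y | graph y !=set0] (fun y => xget 0 (graph y)).

Definition stable_under (D : set V) (A : operator) : Prop :=
  forall x, D x -> dom A x /\ D (A x).

Definition commutator (X Y : V -> V) : V -> V := fun x => X (Y x) - Y (X x).

Definition eigenspace_of (A : operator) (z : R[i]) : set V :=
  [set u | dom A u /\ A u = z *: u].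

Definition eigenvalue_of (A : operator) (z : R[i]) : Prop :=
  exists2 u, eigenspace_of A z u & u != 0.

Definition multiplicity_one (A : operator) (z : R[i]) : Prop :=
  exists2 u : V, u != 0 & eigenspace_of A z = range (fun c : R[i] => c *: u).

Definition schauder_basis (e : nat -> V) : Prop :=
  forall f : V, exists! c : nat -> R[i],
    series (fun n => c n *: e n) @ \oo --> f.

Definition biorthonormal (B : {dot V for Num.conj}) (e e' : nat -> V) : Prop :=
  forall n m, inner B (e n) (e' m) = (n == m)%:R.

End Hilbert.

Arguments operator {R} V.

(* Main.v *)
Require Import Defs.
From HB Require Import structures.
From mathcomp Require Import all_boot all_order all_algebra.
From mathcomp Require Import sesquilinear complex.
From mathcomp Require Import all_classical all_reals all_analysis.

Set Implicit Arguments.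
Unset Strict Implicit.
Unset Printing Implicit Defensive.

Import Order.TTheory GRing.Theory Num.Theory.
Import numFieldNormedType.Exports.

Local Open Scope classical_set_scope.
Local Open Scope ring_scope.
Local Open Scope complex_scope.

(** The vectors [phi n] lie in [D] and, by simplicity of the spectrum of [H],
    induction on [n] gives [H phi_n = E_n phi_n] and [[T,S] phi_n = mu_n phi_n].
    Moving [H^+] and [S^+] to the other side of the scalar product with [phi_k]
    then identifies [H^+ psi_n] and [S^+ psi_n], because a vector orthogonal to
    every element of a Schauder basis vanishes. *)

Section OperatorTheory.
Context {R : realType} {V : completeNormedModType R[i]}.
Implicit Types (A X Y : operator V) (B : {dot V for Num.conj}).

Lemma linear_operatorZ A (a : R[i]) (u : V) :
  linear_operator A -> dom A u -> A (a *: u) = a *: A u.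
Proof.
move=> [[A0 _] AP] Au.
have A00 : A 0 = 0.
  (* With scalar -1 and both vectors 0, linearity reads [A 0 = - A 0 + A 0]. *)
  by have := AP (-1) 0 0 A0 A0; rewrite scaler0 addr0 scaleN1r addNr.
by have := AP a u 0 Au A0; rewrite A00 !addr0.
Qed.

Lemma commutatorZ X Y (D : set V) (a : R[i]) (u : V) :
  linear_operator X -> linear_operator Y ->
  stable_under D X -> stable_under D Y -> D u ->
  commutator X Y (a *: u) = a *: commutator X Y u.
Proof.
move=> Xl Yl DX DY Du; rewrite /commutator scalerBr.
have [[Xu DXu] [Yu DYu]] := (DX _ Du, DY _ Du).
rewrite (linear_operatorZ _ Xl Xu) (linear_operatorZ _ Yl Yu).
rewrite (linear_operatorZ _ Xl (DX _ DYu).1).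
by rewrite (linear_operatorZ _ Yl (DY _ DXu).1).
Qed.

Lemma innerC B (x y : V) : inner B x y = Num.conj (inner B y x).
Proof. by rewrite /inner (hermC B) expr0 mul1r. Qed.

Lemma innerBl B (x y z : V) : inner B (x - y) z = inner B x z - inner B y z.
Proof. exact: linearBr. Qed.

Lemma innerBr B (x y z : V) : inner B x (y - z) = inner B x y - inner B x z.
Proof. exact: linearBl. Qed.

Lemma innerZl B (a : R[i]) (x y : V) :
  inner B (a *: x) y = Num.conj a * inner B x y.
Proof. exact: linearZr_LR. Qed.

Lemma innerZr B (a : R[i]) (x y : V) : inner B x (a *: y) = a * inner B x y.
Proof. exact: linearZl_LR. Qed.

(* Pythagoras: the partial sums [s] of the expansion of [w] are orthogonal to
   [w], so they stay at distance at least [`|w|] from it. *)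
Lemma schauder_basis_total B (e : nat -> V) (w : V) :
  norm_of_inner B -> schauder_basis e ->
  (forall n, inner B w (e n) = 0) -> w = 0.
Proof.
move=> hB eb we; apply/eqP/contraT => w0.
have [c [/cvgrPdist_lt/(_ `|w|)]] := eb w.
rewrite normr_gt0 => /(_ w0) cw _.
have [N _ /(_ N (leqnn N))] := cw.
have ws : inner B w (series (fun n => c n *: e n) N) = 0.
  rewrite /inner seriesEnat linear_sumlz big1// => i _.
  by have := innerZr B (c i) w (e i); rewrite we mulr0.
move: (series _ N) ws => s ws /=.
have sw : inner B s w = 0 by rewrite innerC ws conjC0.
have : `|w| ^+ 2 <= `|w - s| ^+ 2.
  rewrite !hB innerBl !innerBr ws sw subr0 sub0r.
  by rewrite opprK lerDl -hB exprn_ge0.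
by rewrite ler_pXn2r ?nnegrE// => /le_lt_trans h /h; rewrite ltxx.
Qed.

(** The value of the adjoint and [z] have the same scalar product with every [e n], so their
    difference is orthogonal to a basis. That [y] lies in the domain of the adjoint ensures that
    [xget] returns an element of the graph and not its default 0. *)
Lemma adjoint_eq B A (e : nat -> V) (y z : V) :
  norm_of_inner B -> schauder_basis e -> (forall n, dom A (e n)) ->
  (forall n, inner B z (e n) = inner B y (A (e n))) ->
  dom (adjoint B A) y -> adjoint B A y = z.
Proof.
move=> hB eb Ae zP /(xgetPex 0) yP; apply/eqP; rewrite -subr_eq0; apply/eqP.
apply: (schauder_basis_total hB eb) => n.
by rewrite innerBl zP (yP _ (Ae n)) subrr.
Qed.

Lemma multiplicity_one_colinear A (z : R[i]) (u v : V) :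
  multiplicity_one A z -> eigenspace_of A z u -> u != 0 ->
  eigenspace_of A z v -> exists c : R[i], v = c *: u.
Proof.
move=> [w _ ->] [a _ <-] aw0 [b _ <-].
have a0 : a != 0 by apply: contraNneq aw0 => ->; rewrite scale0r.
(* Here [u = a *: w] and [v = b *: w], with [a] invertible. *)
by exists (b / a); rewrite scalerA divfK.
Qed.

End OperatorTheory.

Theorem mainTheorem4 (R : realType) (V : completeNormedModType R[i])
  (B : {dot V for Num.conj}) (hB : norm_of_inner B)
  (H T S : operator V)
  (H_lin : linear_operator H) (T_lin : linear_operator T)
  (S_lin : linear_operator S)
  (D : set V) (D_sub : subspace_set D) (D_dense : dense D)
  (D_H : stable_under D H) (D_T : stable_under D T) (D_S : stable_under D S)
  (D_Ha : stable_under D (adjoint B H)) (D_Ta : stable_under D (adjoint B T))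
  (D_Sa : stable_under D (adjoint B S))
  (lambda : R[i])
  (HS : forall f, D f -> commutator H S f = lambda *: S (commutator T S f))
  (HTS : forall f, D f -> commutator H (commutator T S) f = 0)
  (H_simple : forall z : R[i], eigenvalue_of H z -> multiplicity_one H z)
  (phi0 : V) (D_phi0 : D phi0) (phi0_neq0 : phi0 != 0) (H_phi0 : H phi0 = 0)
  (phi : nat -> V) (phiE : forall n, phi n = iter n S phi0)
  (phi_neq0 : forall n, phi n != 0) (phi_basis : schauder_basis phi)
  (mu : nat -> R[i])
  (muE : forall n,
     mu n = inner B (phi n) (commutator T S (phi n)) / `|phi n| ^+ 2)
  (mu_neq0 : forall n, mu n != 0)
  (E : nat -> R[i]) (EE : forall n, E n = lambda * \sum_(k < n) mu k)
  (psi : nat -> V) (psi_basis : schauder_basis psi)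
  (phi_psi : biorthonormal B phi psi) :
  (forall n, dom (adjoint B H) (psi n) ->
     adjoint B H (psi n) = Num.conj (E n) *: psi n) /\
  (dom (adjoint B S) (psi 0%N) -> adjoint B S (psi 0%N) = 0) /\
  (forall n, (1 <= n)%N -> dom (adjoint B S) (psi n) ->
     adjoint B S (psi n) = psi n.-1).
Proof.
have Dphi n : D (phi n).
  by elim: n => [|n IH]; rewrite phiE //= -phiE; exact: (D_S _ IH).2.
have phiS n : S (phi n) = phi n.+1 by rewrite !phiE.
(* Stated as an implication so that the induction for [H_phi] can use it at rank [n]. Since [[T,S]]
   commutes with [H], it preserves the eigenspace of [E n], which is the line spanned by [phi n]. *)
have K_phi n : H (phi n) = E n *: phi n ->
    commutator T S (phi n) = mu n *: phi n.
  move=> Hn.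
  have DK : D (commutator T S (phi n)).
    rewrite /commutator -scaleN1r addrC; apply: D_sub.2.
      exact: (D_S _ (D_T _ (Dphi n)).2).2.
    exact: (D_T _ (D_S _ (Dphi n)).2).2.
  have En : eigenspace_of H (E n) (phi n).
    by split=> //; exact: (D_H _ (Dphi n)).1.
  have EKn : eigenspace_of H (E n) (commutator T S (phi n)).
    split; first exact: (D_H _ DK).1.
    have /eqP := HTS _ (Dphi n); rewrite {1}/commutator subr_eq0 => /eqP ->.
    by rewrite Hn (commutatorZ _ T_lin S_lin D_T D_S).
  have Esimple : multiplicity_one H (E n).
    by apply: H_simple; exists (phi n).
  have [c Kc] := multiplicity_one_colinear Esimple En (phi_neq0 n) EKn.
  (* Pairing [[T,S] phi_n = c phi_n] with [phi n] gives [c] times the squared norm, so [c] is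
     [mu n]. *)
  rewrite muE {1}Kc Kc innerZr -hB mulfK//.
  by rewrite expf_neq0// normr_eq0.
have H_phi n : H (phi n) = E n *: phi n.
  elim: n => [|n IH].
    by rewrite EE big_ord0 mulr0 scale0r phiE.
  (* [H S phi_n = S H phi_n + lambda S [T,S] phi_n = (E_n + lambda mu_n) phi_{n+1}], and this
     coefficient is [E n.+1]. *)
  have := HS _ (Dphi n); rewrite {1}/commutator (K_phi _ IH) IH.
  have Sn := (D_S _ (Dphi n)).1.
  rewrite !(linear_operatorZ _ S_lin Sn) phiS => /eqP.
  rewrite subr_eq => /eqP ->.
  by rewrite scalerA -scalerDl (EE n.+1) big_ord_recr/= mulrDr -EE addrC.
have psi_phi n k : inner B (psi n) (phi k) = (n == k)%:R.
  by rewrite innerC phi_psi conjC_nat eq_sym.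
have H_dom n : dom H (phi n) by exact: (D_H _ (Dphi n)).1.
have S_dom n : dom S (phi n) by exact: (D_S _ (Dphi n)).1.
split=> [n|]; last split=> [|[//|n] _].
(* The conjugate cancels against the antilinear first slot: it remains to compare [E_n] and [E_k]
   times the Kronecker delta, which agree when [n = k] and vanish otherwise. *)
- apply: (adjoint_eq hB phi_basis) => // k.
  rewrite H_phi innerZl innerZr conjCK !psi_phi.
  by case: eqVneq => [->|]; rewrite ?mulr0.
(* [S] raises the index, so [psi 0] only meets [phi k.+1], to which it is orthogonal. *)
- apply: (adjoint_eq hB phi_basis) => // k.
  by rewrite phiS psi_phi /inner linear0r.
(* The deltas at [(n.+1, k.+1)] and at [(n, k)] coincide by computation. *)
- apply: (adjoint_eq hB phi_basis) => // k.
  by rewrite phiS !psi_phi.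
Qed.
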